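(* Let $k\ge 2$ and $n\ge 1$ be integers. There is a bijection between the set of multicompositions $$C_0^k(n,0)\cup C_0^k(n-1,1)\cup\cdots=\bigcup_{i\ge 0}C_0^k(n-i,i)$$ and the set $B^k(n-1)$. Therefore $$P^k(n)=\sum_{i=0}^{n-1}\ \sum_{m=0}^{n-i-1}\binom{n-i-1}{m}\binom{m}{i}_{k-1}.$$
   Context: For positive integers $k$ and $n$, a $k$-composition of $n$ (multicomposition, internal-zeros form) is an ordered sequence of positive integers with sum $n$ in which, in addition, each positive part except the first may be immediately preceded by up to $k-1$ zeros. $C_0^k(n,\ell)$ is the set of $k$-compositions of $n$ with exactly $\ell$ zeros (empty if $n\le 0$). $B^k(n)$ is the set of compositions of $n$ with parts from $1,1',2,3,\dots,k$, i.e. finite ordered sequences of such symbols with sum $n$, where $1'$ is a second type of part of value $1$ ($B^k(0)$ consists of the empty composition only). The $k$-Pell sequence is defined by $P^k(-k+2)=\cdots=P^k(0)=0$, $P^k(1)=1$, and $P^k(n)=2P^k(n-1)+P^k(n-2)+\cdots+P^k(n-k)$ for $n\ge 2$. The multinomial (polynomial) coefficient is $\binom{n}{\ell}_r=[x^\ell](1+x+\cdots+x^r)^n$, the coefficient of $x^\ell$ in that polynomial. *)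

(* Defs.v *)
From mathcomp Require Import all_boot all_order all_algebra.
From mathcomp Require Import classical_sets functions.

Set Implicit Arguments.
Unset Strict Implicit.
Unset Printing Implicit Defensive.

Import GRing.Theory.

(* [add_zeros p [:: (z1, p1); (z2, p2); ...]] is the sequence
   p, 0^z1, p1, 0^z2, p2, ...: the zeros z_j immediately precede p_j. *)
Definition add_zeros (p : nat) (zps : seq (nat * nat)) : seq nat :=
  p :: flatten [seq rcons (nseq zp.1 0) zp.2 | zp <- zps].

(* The first part is positive, so a k-composition is nonempty and there is
   none of 0.  In particular [C0 k (n - i) i] is empty when i >= n, where the
   subtraction of nat is truncated. *)
Definition kcomposition (k : nat) (s : seq nat) : Prop :=
  exists (p : nat) (zps : seq (nat * nat)),
    [/\ 0 < p,
        all (fun zp => (zp.1 <= k.-1) && (0 < zp.2)) zps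
      & s = add_zeros p zps].

Definition C0 (k n l : nat) : set (seq nat) :=
  [set s | [/\ kcomposition k s, sumn s = n & count_mem 0 s = l]]%classic.

(* [OnePrime] is 1', the second type of part of value 1. *)
Inductive part := Part of nat | OnePrime.

Definition part_val (x : part) : nat := if x is Part j then j else 1.

Definition allowed_part (k : nat) (x : part) : bool :=
  if x is Part j then 1 <= j <= k else true.

Definition B (k n : nat) : set (seq part) :=
  [set s | all (allowed_part k) s /\ sumn (map part_val s) = n]%classic.

(* [pell_table k n] is [:: P n; P (n - 1); ...; P 0]; reading past its end
   gives 0, the value at negative indices. *)
Fixpoint pell_table (k n : nat) : seq nat :=
  match n with
  | 0 => [:: 0]
  | 1 => [:: 1; 0]
  | n'.+1 =>
      let t := pell_table k n' in
      2 * nth 0 t 0 + \sum_(2 <= j < k.+1) nth 0 t j.-1 :: t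
  end.

(* The k-Pell sequence, extended by 0 to all negative indices; the lemmas
   [pell_init], [pell_1] and [pell_rec] are its defining equations. *)
Definition pell (k : nat) (n : int) : nat :=
  if n is Posz m then nth 0 (pell_table k m) 0 else 0.

Lemma pell_init (k : nat) (n : int) :
  (- k%:Z + 2 <= n <= 0)%R -> pell k n = 0.
Proof. by case: n => [[|m]|m] // /andP[]. Qed.

Lemma pell_1 (k : nat) : pell k 1 = 1.
Proof. by []. Qed.

Lemma nth_pell_table (k m j : nat) :
  nth 0 (pell_table k m) j = pell k (m%:Z - j%:Z)%R.
Proof.
elim: m j => [|m IHm] [|j]; rewrite ?subr0 //.
  by rewrite sub0r -NegzE /= nth_nil.
by rewrite subzSS -IHm; case: m {IHm}.
Qed.

Lemma pell_rec (k : nat) (n : int) : (2 <= n)%R ->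
  pell k n = 2 * pell k (n - 1)%R + \sum_(2 <= j < k.+1) pell k (n - j%:Z)%R.
Proof.
case: n => [[|[|m]]|m] // _.
have E j : (0 < j) ->
    nth 0 (pell_table k m.+1) j.-1 = pell k (m.+2%:Z - j%:Z)%R.
  by case: j => // j _; rewrite nth_pell_table subzSS.
rewrite -(E 1) // [LHS]/=; congr (_ + _); rewrite big_nat [RHS]big_nat.
by apply: eq_bigr => j /andP[/ltnW j_gt0 _]; rewrite E.
Qed.

(* [multinom n l r] is the coefficient of x^l in (1 + x + ... + x^r)^n. *)
Definition multinom (n l r : nat) : nat :=
  (((\sum_(j < r.+1) 'X^j : {poly nat}) ^+ n)`_l)%R.

(* Main.v *)
Require Import Defs.
From mathcomp Require Import all_boot all_order all_algebra.
From mathcomp Require Import classical_sets functions.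
From mathcomp Require Import zify.

(** Weigh a multicomposition by its sum plus its number of zeros: the union
of the [C0 k (n - i) i] consists of the k-compositions of weight n.  Such a
sequence is a list of blocks, z zeros followed by a positive part p, where
z < k and the first block has z = 0.  The block weighs
z + p = (z + 1) + (p - 1), so it can be traded for the word made of one
unprimed part z + 1, between 1 and k, and p - 1 copies of 1'.  A word whose
first part is an unprimed 1 splits in exactly one way into such pieces, a new
one starting at each unprimed part; dropping that compulsory 1 leaves an
arbitrary element of [B k (n - 1)] ([encode_add_zeros], [add_zeros_encode],
[decode_add_zeros]).

For the formula, Q = 2x + x^2 + ... + x^k enumerates the parts of
[B k] by value, so the number of these compositions of N is the
coefficient of x^N in 1 + Q + Q^2 + ..., where powers beyond Q^N do not
contribute.  Writing G_M for the sum of the powers below M, the relation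
G_(M+1) = 1 + Q G_M is the recurrence of the k-Pell sequence
([coef_part_series_pell]).  On the other hand Q = x (1 + A) with
A = 1 + x + ... + x^(k-1), and the binomial expansion of (1 + A)^L turns the
coefficient of x^N in the sum of the x^L (1 + A)^L, with i = N - L, into
the double sum ([coef_part_series_multinom]). *)

Import GRing.Theory.

(** * The bijection *)

Definition blocks (zps : seq (nat * nat)) : seq nat :=
  flatten [seq rcons (nseq zp.1 0) zp.2 | zp <- zps].

Definition block_word (zps : seq (nat * nat)) : seq part :=
  flatten [seq Part zp.1.+1 :: nseq zp.2.-1 OnePrime | zp <- zps].

(** The argument [z] counts the zeros read since the last positive part. *)
Fixpoint encode_from (z : nat) (s : seq nat) : seq part :=
  match s with
  | [::] => [::]
  | 0 :: s' => encode_from z.+1 s'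
  | p.+1 :: s' => Part z.+1 :: nseq p OnePrime ++ encode_from 0 s'
  end.

(** The first block has no zero, hence its word starts with a [Part 1] that
carries no information. *)
Definition encode (s : seq nat) : seq part := behead (encode_from 0 s).

(** The argument [p] is the value reached so far by the positive part that is
being rebuilt; it grows with each 1' and is emitted at the next unprimed
part. *)
Fixpoint decode_from (p : nat) (xs : seq part) : seq nat :=
  match xs with
  | [::] => [:: p]
  | OnePrime :: xs' => decode_from p.+1 xs'
  | Part j :: xs' => p :: nseq j.-1 0 ++ decode_from 1 xs'
  end.

Lemma encode_from_blocks (zps : seq (nat * nat)) :
  all (fun zp => 0 < zp.2) zps -> encode_from 0 (blocks zps) = block_word zps.
Proof.
have encode_block y z p s :
    encode_from y (rcons (nseq z 0) p.+1 ++ s)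
    = Part (y + z).+1 :: nseq p OnePrime ++ encode_from 0 s.
  by elim: z y => [|z IHz] y /=; rewrite ?addn0 // IHz addSnnS.
elim: zps => [//|[z [|p]] zps IH] //= zps_gt0.
by rewrite /blocks /= encode_block add0n IH.
Qed.

Lemma encode_add_zeros (p : nat) (zps : seq (nat * nat)) :
  0 < p -> all (fun zp => 0 < zp.2) zps ->
  encode (add_zeros p zps) = nseq p.-1 OnePrime ++ block_word zps.
Proof.
by case: p => // p _ /encode_from_blocks; rewrite /encode /= /blocks => ->.
Qed.

Lemma decode_add_zeros (p : nat) (zps : seq (nat * nat)) :
  0 < p -> all (fun zp => 0 < zp.2) zps ->
  decode_from 1 (nseq p.-1 OnePrime ++ block_word zps) = add_zeros p zps.
Proof.
have decode_ones q m xs :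
    decode_from q (nseq m OnePrime ++ xs) = decode_from (q + m) xs.
  by elim: m q => [|m IHm] q /=; rewrite ?addn0 // IHm addSnnS.
elim: zps p => [|[z q] zps IH] [|p] //= _.
move=> /andP[q_gt0 zps_gt0]; rewrite decode_ones /= add1n IH //.
by rewrite /add_zeros /= cat_rcons.
Qed.

(** Every word is reached: the 1's before the first unprimed part lengthen the
first part, and each unprimed part opens a new block. *)
Lemma add_zeros_encode (k : nat) (xs : seq part) :
  all (allowed_part k) xs ->
  exists (p : nat) (zps : seq (nat * nat)),
    [/\ 0 < p, all (fun zp => (zp.1 <= k.-1) && (0 < zp.2)) zps
      & xs = nseq p.-1 OnePrime ++ block_word zps].
Proof.
elim: xs => [_|x xs IH] /=; first by exists 1, [::].
move=> /andP[x_ok /IH[[|p] [zps [//] _ zps_ok ->]]].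
case: x x_ok => [[//|j] /= j_lt|_]; last by exists p.+2, zps.
by exists 1, ((j, p.+1) :: zps); split=> //=; rewrite zps_ok andbT; lia.
Qed.

(** Block by block z + p = (z + 1) + (p - 1); the successor on the right is
the dropped leading [Part 1]. *)
Lemma sumn_count_add_zeros (p : nat) (zps : seq (nat * nat)) :
  0 < p -> all (fun zp => 0 < zp.2) zps ->
  sumn (add_zeros p zps) + count_mem 0 (add_zeros p zps)
  = (sumn (map part_val (nseq p.-1 OnePrime ++ block_word zps))).+1.
Proof.
elim: zps p => [|[z q] zps IH] [|p] //= _.
  by move=> _; rewrite cats0 map_nseq sumn_nseq /=; lia.
move=> /andP[q_gt0 /(IH q q_gt0)].
rewrite /block_word /= !map_cat /= !map_cat /= !cat_rcons.
rewrite !count_cat !sumn_cat /= !sumn_cat !map_nseq !sumn_nseq count_nseq /=.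
by case: q q_gt0 => //= q _; lia.
Qed.

(** Truncated subtraction does no harm here: a k-composition has positive sum,
which forces i < n in [C0 k (n - i) i]. *)
Lemma bigcup_C0E (k n : nat) (s : seq nat) :
  (\bigcup_(i : nat) C0 k (n - i) i)%classic s <->
  kcomposition k s /\ sumn s + count_mem 0 s = n.
Proof.
split=> [[i _ [s_comp s_sum s_zeros]]|[s_comp s_weight]].
  split=> //; have : 0 < sumn s.
    by have [p [zps [p_gt0 _ ->]]] := s_comp; rewrite /= addn_gt0 p_gt0.
  by lia.
by exists (count_mem 0 s) => //; split=> //; rewrite -s_weight addnK.
Qed.

Lemma encode_bij (k n : nat) : 0 < k -> 1 <= n ->
  set_bij (\bigcup_(i : nat) C0 k (n - i) i)%classic (B k (n - 1)) encode.
Proof.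
move=> k_gt0 n_gt0.
have parts_gt0 (zps : seq (nat * nat)) :
    all (fun zp => (zp.1 <= k.-1) && (0 < zp.2)) zps ->
    all (fun zp => 0 < zp.2) zps.
  by apply: sub_all => zp /andP[].
have encodeK s : kcomposition k s -> decode_from 1 (encode s) = s.
  move=> [p [zps [p_gt0 /parts_gt0 zps_gt0 ->]]].
  by rewrite encode_add_zeros // decode_add_zeros.
split.
- move=> s /bigcup_C0E[[p [zps [p_gt0 zps_ok ->]]]].
  have zps_gt0 := parts_gt0 _ zps_ok.
  rewrite sumn_count_add_zeros // encode_add_zeros // => <-; split; last first.
    by rewrite subn1.
  rewrite all_cat all_nseq orbT /=.
  elim: zps zps_ok {zps_gt0} => //= -[z q] zps IH /andP[/andP[z_le q_gt0] /IH].
  rewrite all_cat all_nseq orbT /= => ->; rewrite andbT.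
  by rewrite -(prednK k_gt0) ltnS.
- move=> s t /set_mem/bigcup_C0E[s_comp _] /set_mem/bigcup_C0E[t_comp _] eq_st.
  by rewrite -(encodeK s s_comp) eq_st encodeK.
- move=> xs [/add_zeros_encode[p [zps [p_gt0 zps_ok ->]]] xs_sum].
  have zps_gt0 := parts_gt0 _ zps_ok.
  exists (add_zeros p zps); last exact: encode_add_zeros.
  apply/bigcup_C0E; split; first by exists p, zps.
  by rewrite sumn_count_add_zeros // xs_sum subn1 prednK.
Qed.

(** * The generating polynomial *)

(** This is Q = 2x + x^2 + ... + x^k = x (1 + A), the enumerator by value of
the parts 1, 1', 2, ..., k.  The factored form serves both uses: in the recurrence, x times 1
accounts for the part 1' and x^(j+1) for the part j + 1; in the double sum,
1 + A is expanded by the binomial theorem. *)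
Definition part_poly (k : nat) : {poly nat} :=
  ('X * (1 + \sum_(j < k) 'X^j))%R.

(** The geometric series of [part_poly k], cut so that it remains a
polynomial: [part_poly k ^+ L] is a multiple of x^L, so powers
L > N do not contribute to the coefficient of x^N. *)
Definition part_series (k M : nat) : {poly nat} :=
  (\sum_(L < M) part_poly k ^+ L)%R.

(** By G_(M+1) = 1 + Q G_M, coefficients of G_(M+1) reduce to coefficients of
smaller index in G_M, which the induction on the cut M covers; this is why
the cut is not tied to N.  The factor x in Q provides the shift, and
the terms of index beyond N vanish on both sides, because k-Pell numbers of
nonpositive index are 0. *)
Lemma coef_part_series_pell (k M N : nat) : 0 < k -> N < M ->
  ((part_series k M)`_N)%R = pell k N.+1%:Z.
Proof.
move=> k_gt0; elim: M N => [//|M IHM] N N_le.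
have -> : part_series k M.+1 = (1 + part_poly k * part_series k M)%R.
  rewrite /part_series big_ord_recl expr0 mulr_sumr.
  by under eq_bigr do rewrite exprS.
rewrite coefD coef1 /part_poly -mulrA coefXM.
case: N N_le => [|N] N_le; first by rewrite pell_1.
rewrite [LHS]/= add0r mulrDl mul1r coefD IHM // mulr_suml coef_sum.
have shifted j : (('X^j * part_series k M)`_N)%R = pell k (N.+1%:Z - j%:Z)%R.
  rewrite coefXnM; case: ltnP => [N_lt|j_le].
    case E : (N.+1%:Z - j%:Z)%R => [[|m]|m] //; lia.
  rewrite IHM; last by lia.
  by congr pell; lia.
rewrite (@pell_rec k N.+2%:Z) // mul2n -addnn.
have -> : (N.+2%:Z - 1 = N.+1%:Z)%R by lia.
have -> : (\sum_(j < k) ('X^j * part_series k M)`_N)%R =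
          \sum_(0 <= j < k) pell k (N.+1%:Z - j%:Z)%R.
  by rewrite big_mkord; apply: eq_bigr => j _; apply: shifted.
rewrite natrDE big_ltn // subr0 [in RHS]big_add1 /= -addnA.
congr (_ + (_ + _)).
by apply: eq_bigr => j _; congr pell; lia.
Qed.

(** The coefficient of x^N in x^L (1 + A)^L is that of x^(N-L) in (1 + A)^L,
and the one of A^m is [multinom m (N - L) (k - 1)] by definition.
Combinatorially, L is the length of a composition in [B k N] and m the number
of its parts other than 1'. *)
Lemma coef_part_series_multinom (k N : nat) : 0 < k ->
  ((part_series k N.+1)`_N)%R =
  \sum_(i < N.+1) \sum_(m < (N - i).+1) 'C(N - i, m) * multinom m i (k - 1).
Proof.
move=> k_gt0.
(* Reversing the sum over L makes i = N - L the index. *)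
rewrite coef_sum (reindex_inj rev_ord_inj) /=; apply: eq_bigr => i _.
have i_le : i <= N by rewrite -ltnS.
rewrite subSS exprMn coefXnM ltnNge leq_subr /= subKn // exprDn coef_sum.
apply: eq_bigr => m _; rewrite expr1n mul1r coefMn -mulr_natl natn.
by rewrite /multinom subn1 prednK.
Qed.

Theorem theorem12 (k n : nat) (hk : 2 <= k) (hn : 1 <= n) :
  (exists f : seq nat -> seq part,
     set_bij (\bigcup_(i : nat) C0 k (n - i) i)%classic (B k (n - 1)) f) /\
  pell k n%:Z =
    \sum_(0 <= i < n) \sum_(0 <= m < n - i)
      'C(n - i - 1, m) * multinom m i (k - 1).
Proof.
have k_gt0 : 0 < k by apply: ltnW.
split; first by exists encode; apply: encode_bij.
case: n hn => // N _; rewrite -(@coef_part_series_pell k N.+1) //.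
rewrite coef_part_series_multinom // [RHS]big_mkord; apply: eq_bigr => i _.
have i_le : i <= N by rewrite -ltnS.
by rewrite subSn // subSS subn0 big_mkord.
Qed.
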